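(* Suppose $(U,S)$ is a weak action pair in a monoid $M$. (i) There exists a proper action pair $(U',S')$ in a monoid $M'$, with $U'\cong U$ and $S'\cong S$, and a surjective semigroup morphism $\psi:U'S'\to US$. (ii) If $S$ is a submonoid of $M$, then such a pair and surjective morphism exist for which: $S'$ is a submonoid of $M'$; $U'$ is a subsemigroup of $U'S'$; and the restriction $\psi|_{U'}$ is an isomorphism $U'\to U$. (iii) If $s^+\in U$ for all $s\in S$ (including the case that $U$ is a submonoid of $M$), then such a pair and surjective morphism exist for which: $S'$ is a subsemigroup of $U'S'$; and the restriction $\psi|_{S'}$ is an isomorphism $S'\to S$.
   Context: For a subsemigroup $U$ of a monoid $M$ with identity $1$, write $U^1=U\cup\{1\}$. A left action of $S$ on $U^1$ is by semigroup morphisms if ${}^s({}^tu)={}^{st}u$ and ${}^s(uv)={}^su\cdot{}^sv$ for all $s,t\in S$, $u,v\in U^1$. A weak action pair in $M$ is a pair $(U,S)$ of subsemigroups of $M$ together with a left action of $S$ on $U^1$ by semigroup morphisms such that (A1) $s\cdot u={}^su\cdot s$ for all $s\in S$, $u\in U^1$. It is an action pair if also (A2) $us=vt\Rightarrow u\cdot{}^s1=v\cdot{}^t1$ for all $u,v\in U^1$, $s,t\in S$. Write $s^+={}^s1\in U^1$ for $s\in S$. The set $US=\{us:u\in U,s\in S\}$ is a subsemigroup of $M$. Properness. Let $S^+=\{s^+:s\in S\}$ and let $P=\langle S^+\rangle$ be the subsemigroup of $U^1$ generated by $S^+$. Let $\kappa=\{(s,t)\in S\times S: ps=qt \text{ for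 some } p,q\in P\}$ and let $\sigma=\kappa^\sharp$ be the congruence on $S$ generated by $\kappa$. The weak action pair $(U,S)$ is proper if for all $u,v\in U^1$ and $s,t\in S$: $$us=vt\iff us^+=vt^+\text{ and }s\mathrel\sigma t .$$ (Any proper weak action pair is automatically an action pair.) *)

(* Defs.v *)
From mathcomp Require Import all_boot.
From mathcomp Require Import boolp classical_sets functions.

Set Implicit Arguments.
Unset Strict Implicit.
Unset Printing Implicit Defensive.

Local Open Scope classical_set_scope.
Local Open Scope group_scope.

(* Semigroups and monoids are possibly infinite; subsemigroups are sets in the
   sense of [classical_sets], and may be empty. *)

Definition subsemigroup (M : monoidType) (A : set M) : Prop :=
  forall x y, A x -> A y -> A (x * y).

Definition submonoid (M : monoidType) (A : set M) : Prop :=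
  subsemigroup A /\ A 1.

Definition adjoin1 (M : monoidType) (U : set M) : set M := U `|` [set 1].

Definition set_mul (M : monoidType) (U S : set M) : set M :=
  [set u * s | u in U & s in S].

(* Morphisms between subsemigroups are functions on the ambient monoids; only
   their values on the subsemigroup [A] are relevant. *)
Definition semigroup_morphism (M N : monoidType) (A : set M) (B : set N)
    (f : M -> N) : Prop :=
  set_fun A B f /\ {in A &, {morph f : x y / x * y}}.

Definition surjective_morphism (M N : monoidType) (A : set M) (B : set N)
    (f : M -> N) : Prop :=
  semigroup_morphism A B f /\ set_surj A B f.

Definition isomorphism (M N : monoidType) (A : set M) (B : set N)
    (f : M -> N) : Prop :=
  semigroup_morphism A B f /\ set_bij A B f.

Definition isomorphic (M N : monoidType) (A : set M) (B : set N) : Prop :=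
  exists f : M -> N, isomorphism A B f.

(* [act s u] stands for the left action of [s] on [u]; only its values for
   [s] in [S] and [u] in [adjoin1 U] are relevant. *)
Record left_action_by_morphisms (M : monoidType) (U S : set M)
    (act : M -> M -> M) : Prop := LeftActionByMorphisms {
  act_closed : forall s u, S s -> adjoin1 U u -> adjoin1 U (act s u);
  act_comp : forall s t u, S s -> S t -> adjoin1 U u ->
    act s (act t u) = act (s * t) u;
  act_morph : forall s u v, S s -> adjoin1 U u -> adjoin1 U v ->
    act s (u * v) = act s u * act s v
}.

Record weak_action_pair (M : monoidType) (U S : set M)
    (act : M -> M -> M) : Prop := WeakActionPair {
  wap_subU : subsemigroup U;
  wap_subS : subsemigroup S;
  wap_action : left_action_by_morphisms U S act;
  wap_A1 : forall s u, S s -> adjoin1 U u -> s * u = act s u * s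
}.

Record action_pair (M : monoidType) (U S : set M)
    (act : M -> M -> M) : Prop := ActionPair {
  ap_weak : weak_action_pair U S act;
  ap_A2 : forall u v s t, adjoin1 U u -> adjoin1 U v -> S s -> S t ->
    u * s = v * t -> u * act s 1 = v * act t 1
}.

Definition splus (M : monoidType) (act : M -> M -> M) (s : M) : M := act s 1.

Definition Splus (M : monoidType) (S : set M) (act : M -> M -> M) : set M :=
  splus act @` S.

Definition Pgen (M : monoidType) (S : set M) (act : M -> M -> M) : set M :=
  smallest (@subsemigroup M) (Splus S act).

Definition kappa (M : monoidType) (S : set M) (act : M -> M -> M) :
    set (M * M) :=
  [set st | [/\ S st.1, S st.2 &
    exists p q, [/\ Pgen S act p, Pgen S act q & p * st.1 = q * st.2]]].

Record congruence_on (M : monoidType) (S : set M) (R : set (M * M)) : Prop :=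
  CongruenceOn {
  cong_sub : R `<=` S `*` S;
  cong_refl : forall s, S s -> R (s, s);
  cong_sym : forall s t, R (s, t) -> R (t, s);
  cong_trans : forall r s t, R (r, s) -> R (s, t) -> R (r, t);
  cong_mul : forall s t s' t', R (s, t) -> R (s', t') -> R (s * s', t * t')
}.

Definition sigma (M : monoidType) (S : set M) (act : M -> M -> M) :
    set (M * M) :=
  smallest (congruence_on S) (kappa S act).

Definition proper (M : monoidType) (U S : set M) (act : M -> M -> M) : Prop :=
  forall u v s t, adjoin1 U u -> adjoin1 U v -> S s -> S t ->
    (u * s = v * t <->
     u * splus act s = v * splus act t /\ sigma S act (s, t)).

Definition proper_action_pair (M : monoidType) (U S : set M)
    (act : M -> M -> M) : Prop :=
  action_pair U S act /\ proper U S act.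

(* Main.v *)
Require Import Defs.
From HB Require Import structures.
From mathcomp Require Import all_boot.
From mathcomp Require Import boolp classical_sets functions.

(** The pair is a semidirect product, cut down to become a monoid.  On pairs
    [(u, s)] with [u] in [U^1] and [s] in [S^1], the law
    [(u, s)(v, t) = (u . ^s v, s t)] is associative and has the left identity
    [(1, 1)], but [(u, s)(1, 1) = (u s^+, s)].  The pairs with [u s^+ = u] are
    closed under this law, and on them [(1, 1)] is a two-sided identity; they
    form the monoid [M'].

    Inside [M'], the pairs [(u, 1)] with [u] in [U] form a copy [U'] of [U],
    and the pairs [(s^+, s)] with [s] in [S] form a copy [S'] of [S] because
    [s^+ . ^s(t^+) = ^s(1 . t^+) = (st)^+].  Let [S'] act through its second
    component.  As [(u, 1)(s^+, s) = (u s^+, s)], an equation between such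
    products says that the second components agree and that the first ones,
    [u s^+] and [v t^+], agree.  All elements of [P'] have second component
    [1], so [kappa'] and hence [sigma'] is equality on [S'], and the pair is
    proper ([lift_proper]).

    By (A1) the map [psi (u, s) = u s] is a morphism on all of [M'], and by
    (A1) with [u = 1] also [s^+ s = s]; so [psi] sends [(u, 1)] to [u] and
    [(s^+, s)] to [s], and it maps [U'S'] onto [US].  The three parts of the
    theorem use this same pair and this same [psi]: if [1] is in [S] then
    [(1, 1)] is in [S'] and [U'] lies in [U'S'], and if every [s^+] is in [U]
    then [(s^+, s) = (s^+, 1)(s^+, s)] puts [S'] inside [U'S']. *)

Set Implicit Arguments.
Unset Strict Implicit.
Unset Printing Implicit Defensive.

Local Open Scope classical_set_scope.
Local Open Scope group_scope.

(** * Isomorphisms depend only on the values on their domain *)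

Lemma isomorphism_ext (M N : monoidType) (A : set M) (B : set N)
    (f g : M -> N) :
  subsemigroup A -> (forall x, A x -> g x = f x) ->
  isomorphism A B f -> isomorphism A B g.
Proof.
move=> hA gf [[fAB fM] [_ finj fsurj]].
have gAB : set_fun A B g by move=> x Ax; rewrite gf //; apply: fAB.
split; split=> //.
- move=> x y Ax Ay; move: (set_mem Ax) (set_mem Ay) => hx hy.
  by rewrite !gf ?fM //; apply: hA.
- by move=> x y Ax Ay; rewrite !gf; [apply: finj | apply: set_mem..].
- by move=> b /fsurj[x Ax <-]; exists x; rewrite ?gf.
Qed.

(** * Extending the action to the monoid obtained from S by adjoining 1 *)

Lemma adjoin1_one (M : monoidType) (A : set M) : adjoin1 A 1.
Proof. by right. Qed.

Lemma adjoin1_subsemigroup (M : monoidType) (A : set M) :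
  subsemigroup A -> subsemigroup (adjoin1 A).
Proof.
move=> hA x y [Ax|->] [Ay|->]; rewrite ?mul1g ?mulg1; last exact: adjoin1_one.
- by left; apply: hA.
- by left.
- by left.
Qed.

(** The monoid [M'] needs second components in [S^1], so its law calls for
    the action of [1] as well. *)
Definition ext_act (M : monoidType) (act : M -> M -> M) (s u : M) : M :=
  if s == 1 then u else act s u.

Lemma ext_act1 (M : monoidType) (act : M -> M -> M) u : ext_act act 1 u = u.
Proof. by rewrite /ext_act eqxx. Qed.

(** If [1] already lies in [S], then (A1) forces it to act trivially:
    [u = 1 . u = ^1 u . 1]. *)
Lemma ext_actE (M : monoidType) (U S : set M) (act : M -> M -> M) s u :
  weak_action_pair U S act -> S s -> adjoin1 U u -> ext_act act s u = act s u.
Proof.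
move=> hUS Ss Uu; rewrite /ext_act; case: eqP => // s1.
by have := wap_A1 hUS Ss Uu; rewrite s1 mul1g mulg1.
Qed.

Lemma ext_weak_action_pair (M : monoidType) (U S : set M)
    (act : M -> M -> M) :
  weak_action_pair U S act -> weak_action_pair U (adjoin1 S) (ext_act act).
Proof.
move=> hUS; have [hU hS [hcl hco hmo] hA1] := hUS.
have extE := ext_actE hUS.
split=> //; first exact: adjoin1_subsemigroup.
- split=> [s u [Ss|->] Uu | s t u [Ss|->] [St|->] Uu | s u v [Ss|->] Uu Uv];
    rewrite ?mul1g ?mulg1 ?ext_act1 //.
  + by rewrite extE //; apply: hcl.
  + by rewrite !extE ?hco //; [apply: hS | apply: hcl].
  + have Uuv : adjoin1 U (u * v) by apply: adjoin1_subsemigroup.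
    by rewrite !extE ?hmo.
- move=> s u [Ss|->] Uu; first by rewrite extE // hA1.
  by rewrite ext_act1 mul1g mulg1.
Qed.

(** * The monoid of tight pairs *)

Section TightPairs.
Variables (M : monoidType) (U S : set M) (act : M -> M -> M).
Hypothesis hUS : weak_action_pair U S act.

Local Notation "s ^> u" := (ext_act act s u) (at level 30).
Local Notation U1 := (adjoin1 U).
Local Notation S1 := (adjoin1 S).

Let hext := ext_weak_action_pair hUS.
Let mulU := adjoin1_subsemigroup (wap_subU hUS).
Let mulS := adjoin1_subsemigroup (wap_subS hUS).
Let actU := act_closed (wap_action hext).
Let actA := act_comp (wap_action hext).
Let actM := act_morph (wap_action hext).
Let U1_1 : U1 1 := adjoin1_one U.
Let S1_1 : S1 1 := adjoin1_one S.

Definition tight (x : M * M) : Prop :=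
  [/\ U1 x.1, S1 x.2 & x.1 * (x.2 ^> 1) = x.1].

(** The proof that [(U, S)] is a weak action pair is a parameter of the type
    so that the monoid structure, which depends on it, can be inferred. *)
Definition tight_pair of weak_action_pair U S act : Type :=
  {x : M * M | `[< tight x >]}.

HB.instance Definition _ := Choice.copy (tight_pair hUS)
  {x : M * M | `[< tight x >]}.

Local Notation E := (tight_pair hUS).

Definition left_part (x : E) : M := (val x).1.
Definition right_part (x : E) : M := (val x).2.

Lemma left_partP x : U1 (left_part x).
Proof. by case: (asboolP _ (svalP x)). Qed.

Lemma right_partP x : S1 (right_part x).
Proof. by case: (asboolP _ (svalP x)). Qed.

Lemma tight_partP x : left_part x * (right_part x ^> 1) = left_part x.
Proof. by case: (asboolP _ (svalP x)). Qed.

Lemma tight_pair_inj (x y : E) :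
  left_part x = left_part y -> right_part x = right_part y -> x = y.
Proof.
move=> e1 e2; apply: val_inj; rewrite /= (surjective_pairing (val x)).
by rewrite (surjective_pairing (val y)); congr pair.
Qed.

Definition mk_tight (u s : M) (h : tight (u, s)) : E :=
  exist (fun x => `[< tight x >]) (u, s) (asboolT h).

Lemma one_tight : tight (1, 1).
Proof. by split; rewrite //= ext_act1 mulg1. Qed.

Lemma mul_tight (x y : E) :
  tight (left_part x * (right_part x ^> left_part y),
         right_part x * right_part y).
Proof.
have [[Ux Sx] [Uy Sy]] := ((left_partP x, right_partP x),
                           (left_partP y, right_partP y)).
split=> /=; first by apply: mulU => //; apply: actU.
  exact: mulS.
rewrite -actA // -mulgA -actM ?tight_partP //; exact: actU.
Qed.

Definition tight_mul (x y : E) : E := mk_tight (mul_tight x y).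

Lemma tight_mulA : associative tight_mul.
Proof.
move=> x y z; apply: tight_pair_inj; rewrite /left_part /right_part /=;
  rewrite ?mulgA //.
have [[Sx Uy] [Sy Uz]] := ((right_partP x, left_partP y),
                           (right_partP y, left_partP z)).
by rewrite actM ?actA ?mulgA //; apply: actU.
Qed.

Lemma tight_mul1x : left_id (mk_tight one_tight) tight_mul.
Proof.
move=> x; apply: tight_pair_inj; rewrite /left_part /right_part /= ?mul1g //.
by rewrite ext_act1.
Qed.

Lemma tight_mulx1 : right_id (mk_tight one_tight) tight_mul.
Proof.
move=> x; apply: tight_pair_inj; rewrite /= ?/right_part /= ?mulg1 //.
exact: tight_partP.
Qed.

HB.instance Definition _ := isMonoid.Build (tight_pair hUS)
  tight_mulA tight_mul1x tight_mulx1.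

Lemma left_partM (x y : E) :
  left_part (x * y) = left_part x * (right_part x ^> left_part y).
Proof. by []. Qed.

Lemma right_partM (x y : E) : right_part (x * y) = right_part x * right_part y.
Proof. by []. Qed.

Lemma left_part1 : left_part (1 : E) = 1. Proof. by []. Qed.

Lemma right_part1 : right_part (1 : E) = 1. Proof. by []. Qed.

(** * The lifted pair *)

Definition liftU : set E := [set x | U (left_part x) /\ right_part x = 1].

Definition liftS : set E :=
  [set x | S (right_part x) /\ left_part x = right_part x ^> 1].

Lemma adjoin1_liftU x :
  adjoin1 liftU x -> U1 (left_part x) /\ right_part x = 1.
Proof. by case=> [[Ux x1]|->]; split=> //; left. Qed.

Lemma adjoin1_liftUI (x : E) : right_part x = 1 -> adjoin1 liftU x.
Proof.
move=> x1; case: (left_partP x) => [Ux|xu1]; first by left.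
by right; apply: tight_pair_inj.
Qed.

Lemma inU_tight u : U1 u -> tight (u, 1).
Proof. by split=> //=; rewrite ext_act1 mulg1. Qed.

Lemma inS_tight s : S s -> tight (s ^> 1, s).
Proof.
move=> Ss; have S1s : S1 s by left.
by split=> //=; [apply: actU | rewrite -actM // mulg1].
Qed.

Lemma lift_act_tight (x y : E) : tight (right_part x ^> left_part y, 1).
Proof.
by apply: inU_tight; apply: actU; [exact: right_partP | exact: left_partP].
Qed.

Definition lift_act (x y : E) : E := mk_tight (lift_act_tight x y).

Lemma left_part_act (x y : E) :
  left_part (lift_act x y) = right_part x ^> left_part y.
Proof. by []. Qed.

Lemma right_part_act (x y : E) : right_part (lift_act x y) = 1.
Proof. by []. Qed.

Lemma mul_liftU x y : right_part x = 1 ->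
  left_part (x * y) = left_part x * left_part y.
Proof. by move=> x1; rewrite left_partM x1 ext_act1. Qed.

Lemma subsemigroup_liftU : subsemigroup liftU.
Proof.
move=> x y [Ux x1] [Uy y1]; split; last by rewrite right_partM x1 y1 mul1g.
by rewrite mul_liftU //; apply: (wap_subU hUS).
Qed.

(** This is the identity [s^+ . ^s(t^+) = ^s(1 . t^+) = (st)^+]. *)
Lemma subsemigroup_liftS : subsemigroup liftS.
Proof.
move=> x y [Sx ex] [Sy ey]; split; first exact: (wap_subS hUS).
rewrite left_partM right_partM ex ey.
have [S1x S1y] := (right_partP x, right_partP y).
by rewrite -actM ?mul1g ?actA //; apply: actU.
Qed.

Lemma lift_weak_action_pair : weak_action_pair liftU liftS lift_act.
Proof.
split; [exact: subsemigroup_liftU | exact: subsemigroup_liftS | split |].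
- by move=> x y _ _; apply: adjoin1_liftUI.
- move=> x y z _ _ _; apply: tight_pair_inj => //.
  apply: actA; [exact: right_partP | exact: right_partP | exact: left_partP].
- move=> x y z _ /adjoin1_liftU[Uy y1] /adjoin1_liftU[Uz z1].
  have Sx := right_partP x.
  apply: tight_pair_inj; last by rewrite right_partM mulg1.
  by rewrite mul_liftU // !left_part_act mul_liftU // actM.
- move=> x y [Sx ex] /adjoin1_liftU[Uy y1]; have S1x := right_partP x.
  apply: tight_pair_inj; last by rewrite !right_partM y1 mulg1 mul1g.
  rewrite left_partM mul_liftU // left_part_act ex.
  by rewrite -!actM // mul1g mulg1.
Qed.

Lemma right_part_Pgen p : Pgen liftS lift_act p -> right_part p = 1.
Proof.
apply: (@smallest_sub _ _ _ [set x : E | right_part x = 1]) => [x y /= x1 y1|].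
  by rewrite right_partM x1 y1 mulg1.
by move=> _ [s _ <-].
Qed.

(** [P'] consists of pairs with second component [1], so elements of [S']
    related by [kappa'] have the same second component, which determines
    them. *)
Lemma sigma_liftS x y : sigma liftS lift_act (x, y) -> liftS x /\ x = y.
Proof.
pose D := [set z : E * E | liftS z.1 /\ z.1 = z.2].
apply: (@smallest_sub _ _ _ D) => [|[a b] [/= Sa Sb [p [q [Pp Pq]]]]].
  split=> [[a b]|a Sa|a b|a b c|a b c d] //=; rewrite /D /=.
  - by move=> [Sa <-].
  - by move=> [Sa <-].
  - by move=> [Sa <-].
  - by move=> [Sa <-] [Sb <-]; split=> //; apply: subsemigroup_liftS.
move=> /= /(congr1 right_part).
rewrite !right_partM (right_part_Pgen Pp) (right_part_Pgen Pq) !mul1g.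
move=> e; split=> //; apply: tight_pair_inj => //.
by rewrite Sa.2 Sb.2 e.
Qed.

(** With [(u, 1)] for [x] and [(t^+, t)] for [s], both sides are [u t^+]. *)
Lemma left_part_liftUS x s : adjoin1 liftU x -> liftS s ->
  left_part (x * s) = left_part (x * splus lift_act s).
Proof.
by move=> /adjoin1_liftU[_ x1] [_ es]; rewrite !mul_liftU // es.
Qed.

Lemma lift_proper : Defs.proper liftU liftS lift_act.
Proof.
move=> x y s t Ux Uy Ss St.
have [_ x1] := adjoin1_liftU Ux; have [_ y1] := adjoin1_liftU Uy.
split=> [e|[e /sigma_liftS[_ est]]]; last first.
  apply: tight_pair_inj; last by rewrite !right_partM x1 y1 est.
  by rewrite (left_part_liftUS Ux Ss) (left_part_liftUS Uy St) e.
have est : right_part s = right_part t.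
  by move: (congr1 right_part e); rewrite !right_partM x1 y1 !mul1g.
split; last first.
  have -> : s = t by apply: tight_pair_inj => //; rewrite Ss.2 St.2 est.
  by move=> R [hR _]; apply: cong_refl hR _ St.
apply: tight_pair_inj; last by rewrite !right_partM x1 y1.
by rewrite -(left_part_liftUS Ux Ss) -(left_part_liftUS Uy St) e.
Qed.

Lemma lift_proper_action_pair : proper_action_pair liftU liftS lift_act.
Proof.
split; last exact: lift_proper; split; first exact: lift_weak_action_pair.
by move=> x y s t Ux Uy Ss St /lift_proper[].
Qed.

Lemma left_part_isomorphism : isomorphism liftU U left_part.
Proof.
split; [split|split].
- by move=> x [].
- by move=> x y /set_mem[_ x1] _; rewrite mul_liftU.
- by move=> x [].
- move=> x y /set_mem[_ x1] /set_mem[_ y1] e.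
  by apply: tight_pair_inj; rewrite // x1.
- move=> u Uu; have U1u : U1 u by left.
  by exists (mk_tight (inU_tight U1u)).
Qed.

Lemma right_part_isomorphism : isomorphism liftS S right_part.
Proof.
split; [split|split].
- by move=> x [].
- by [].
- by move=> x [].
- move=> x y /set_mem[_ ex] /set_mem[_ ey] e.
  by apply: tight_pair_inj; rewrite // ex ey e.
- by move=> s Ss; exists (mk_tight (inS_tight Ss)).
Qed.

Definition eval_pair (x : E) : M := left_part x * right_part x.

(** By (A1), [(u . ^s v) s t = u s . v t]. *)
Lemma eval_pairM (x y : E) : eval_pair (x * y) = eval_pair x * eval_pair y.
Proof.
rewrite /eval_pair left_partM right_partM -!mulgA; congr (_ * _).
by rewrite !mulgA -(wap_A1 hext) //; [exact: right_partP | exact: left_partP].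
Qed.

Lemma eval_pair_liftU x : liftU x -> eval_pair x = left_part x.
Proof. by move=> [_ x1]; rewrite /eval_pair x1 mulg1. Qed.

Lemma eval_pair_liftS x : liftS x -> eval_pair x = right_part x.
Proof.
move=> [Sx ex]; have S1x := right_partP x.
by rewrite /eval_pair ex -(wap_A1 hext) // mulg1.
Qed.

Lemma eval_pair_liftU_isomorphism : isomorphism liftU U eval_pair.
Proof.
apply: isomorphism_ext left_part_isomorphism; first exact: subsemigroup_liftU.
exact: eval_pair_liftU.
Qed.

Lemma eval_pair_liftS_isomorphism : isomorphism liftS S eval_pair.
Proof.
apply: isomorphism_ext right_part_isomorphism; first exact: subsemigroup_liftS.
exact: eval_pair_liftS.
Qed.

Lemma eval_pair_surjective :
  surjective_morphism (set_mul liftU liftS) (set_mul U S) eval_pair.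
Proof.
split; first split.
- move=> _ [x Ux [s Ss <-]]; rewrite eval_pairM.
  rewrite (eval_pair_liftU Ux) (eval_pair_liftS Ss).
  by exists (left_part x); [case: Ux | exists (right_part s); [case: Ss|]].
- by move=> x y _ _; apply: eval_pairM.
- move=> _ [u Uu [s Ss <-]].
  have [_ [_ _ /(_ u Uu)[x Ux <-]]] := eval_pair_liftU_isomorphism.
  have [_ [_ _ /(_ s Ss)[y Sy <-]]] := eval_pair_liftS_isomorphism.
  by exists (x * y); [exists x => //; exists y | rewrite eval_pairM].
Qed.

Lemma submonoid_liftS : submonoid S -> submonoid liftS.
Proof.
move=> [_ S_1]; split; first exact: subsemigroup_liftS.
by split; rewrite /= ?left_part1 ?right_part1 ?ext_act1.
Qed.

Lemma liftU_sub_mul : submonoid S -> liftU `<=` set_mul liftU liftS.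
Proof.
move=> /submonoid_liftS[_ S_1] x Ux.
by exists x => //; exists 1 => //; rewrite mulg1.
Qed.

Lemma liftS_sub_mul :
  (forall s, S s -> U (splus act s)) -> liftS `<=` set_mul liftU liftS.
Proof.
move=> hplus x Sx; have S1x := right_partP x.
(* The left factor is [x^+], that is, the pair [(s^+, 1)]. *)
exists (splus lift_act x).
  by split=> //; rewrite left_part_act (ext_actE hUS Sx.1) //; apply/hplus/Sx.1.
exists x => //.
by have := wap_A1 lift_weak_action_pair Sx (adjoin1_one _); rewrite mulg1.
Qed.

End TightPairs.

Arguments left_part {M U S act} hUS.
Arguments right_part {M U S act} hUS.
Arguments liftU {M U S act} hUS.
Arguments liftS {M U S act} hUS.
Arguments lift_act {M U S act} hUS.
Arguments eval_pair {M U S act} hUS.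

(** * Existence of proper lifts *)

Theorem theorem5p39 (M : monoidType) (U S : set M) (act : M -> M -> M)
    (hUS : weak_action_pair U S act) :
  (exists (M' : monoidType) (U' S' : set M') (act' : M' -> M' -> M')
      (psi : M' -> M),
    [/\ proper_action_pair U' S' act',
        isomorphic U' U,
        isomorphic S' S &
        surjective_morphism (set_mul U' S') (set_mul U S) psi])
  /\
  (submonoid S ->
   exists (M' : monoidType) (U' S' : set M') (act' : M' -> M' -> M')
      (psi : M' -> M),
    [/\ proper_action_pair U' S' act',
        isomorphic U' U,
        isomorphic S' S &
        surjective_morphism (set_mul U' S') (set_mul U S) psi] /\
    [/\ submonoid S',
        subsemigroup U' /\ U' `<=` set_mul U' S' &
        isomorphism U' U psi])
  /\
  ((forall s, S s -> U (splus act s)) ->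
   exists (M' : monoidType) (U' S' : set M') (act' : M' -> M' -> M')
      (psi : M' -> M),
    [/\ proper_action_pair U' S' act',
        isomorphic U' U,
        isomorphic S' S &
        surjective_morphism (set_mul U' S') (set_mul U S) psi] /\
    [/\ subsemigroup S',
        S' `<=` set_mul U' S' &
        isomorphism S' S psi]).
Proof.
have base : [/\ proper_action_pair (liftU hUS) (liftS hUS) (lift_act hUS),
    isomorphic (liftU hUS) U, isomorphic (liftS hUS) S &
    surjective_morphism (set_mul (liftU hUS) (liftS hUS)) (set_mul U S)
      (eval_pair hUS)].
  split; first exact: lift_proper_action_pair.
  - by exists (left_part hUS); apply: left_part_isomorphism.
  - by exists (right_part hUS); apply: right_part_isomorphism.
  - exact: eval_pair_surjective.
split; last split.
- by exists (tight_pair hUS), (liftU hUS), (liftS hUS), (lift_act hUS),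
    (eval_pair hUS).
- move=> hS.
  exists (tight_pair hUS), (liftU hUS), (liftS hUS), (lift_act hUS),
    (eval_pair hUS); split=> //; split.
  + exact: submonoid_liftS.
  + by split; [exact: subsemigroup_liftU | exact: liftU_sub_mul].
  + exact: eval_pair_liftU_isomorphism.
- move=> hplus.
  exists (tight_pair hUS), (liftU hUS), (liftS hUS), (lift_act hUS),
    (eval_pair hUS); split=> //; split.
  + exact: subsemigroup_liftS.
  + exact: liftS_sub_mul.
  + exact: eval_pair_liftS_isomorphism.
Qed.
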